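(* Let $\Phi:\mathcal{D}_{+}\to\mathcal{P}(\mathbb{R})$ be a map such that $\Phi[T_{\#}f]=T_{\#}\Phi[f]$ for every $f\in\mathcal{D}_{+}$ and every increasing homeomorphism $T$ of $\mathbb{R}$ onto an open interval with $T_{\#}f\in\mathcal{D}_{+}$. Then there is a fixed probability measure $\gamma$ on $(0,1)$ (not depending on $f$) such that $\Phi[f]=(Q_{f})_{\#}\gamma$ for all $f\in\mathcal{D}_{+}$. If moreover $\Phi$ maps into absolutely continuous laws, then $\gamma=w\,dz$ for some $w\in\mathcal{W}$, and $\Phi=\rho_{w}$ on $\mathcal{D}_{+}$, i.e. $\Phi[f]$ has density $w(F_{f}(x))f(x)$ for every $f\in\mathcal{D}_{+}$.
   Context: $\mathcal{P}(\mathbb{R})$ is the set of Borel probability measures on $\mathbb{R}$. Absolutely continuous laws are identified with their densities. $\mathcal{D}_{+}$ is the set of probability densities on $\mathbb{R}$ that are continuous and strictly positive on an open interval (bounded or not) and vanish outside it. For $f\in\mathcal{D}_{+}$, $F_{f}(x)=\int_{-\infty}^{x}f$ is the distribution function and $Q_{f}=F_{f}^{-1}:(0,1)\to\mathbb{R}$ the quantile function. $T_{\#}$ denotes pushforward of measures. $\mathcal{W}$ is the set of kernels, i.e. probability densities $w$ on $[0,1]$, and for $w\in\mathcal{W}$ the derangetropy operator is $\rho_{w}[f](x)=w(F_{f}(x))\,f(x)$. *)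

(* Defs.v *)
From HB Require Import structures.
From mathcomp Require Import all_boot all_order all_algebra.
From mathcomp Require Import all_classical all_reals all_analysis.

Set Implicit Arguments.
Unset Strict Implicit.
Unset Printing Implicit Defensive.

Import Order.TTheory GRing.Theory Num.Theory.
Import numFieldNormedType.Exports.

Local Open Scope classical_set_scope.
Local Open Scope ring_scope.

Notation borel_prob R := (probability (measurableTypeR R) R).

(* Library measures are total functions on sets, with unspecified values off
   the Borel sets, so laws are compared on Borel sets only. *)
Definition eq_law (R : realType) (mu nu : set (measurableTypeR R) -> \bar R) :=
  forall A : set (measurableTypeR R), measurable A -> mu A = nu A.

Definition law (R : realType) (f : R -> R) (A : set (measurableTypeR R))
    : \bar R :=
  (\int[@lebesgue_measure R]_(x in A) (f x)%:E)%E.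

(* No measurability clause: it follows from the conditions on I, and I is
   nonempty since f has mass 1.  A law has at most one density in this class,
   so a law and its density can be identified. *)
Definition Dplus (R : realType) : set (R -> R) :=
  [set f : R -> R |
    (exists I : set R,
       [/\ open I, is_interval I, {within I, continuous f},
           (forall x, I x -> 0 < f x) & (forall x, ~ I x -> f x = 0)]) /\
    law f setT = 1%E].
Arguments Dplus R : clear implicits.

Definition distr_fun (R : realType) (f : R -> R) (x : R) : R :=
  \int[@lebesgue_measure R]_(t in `]-oo, x]) f t.

(* For f in Dplus, distr_fun f is a bijection from the interval where f is
   positive onto ]0, 1[; this is its inverse there (and a constant elsewhere). *)
Definition quantile_fun (R : realType) (f : R -> R) : R -> R :=
  pinv [set x | 0 < f x] (distr_fun f).

Definition increasing_homeo (R : realType) (T : R -> R) :=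
  [/\ {homo T : x y / x < y}, continuous T, open (range T),
      is_interval (range T) &
      exists2 S : R -> R, cancel T S & {within range T, continuous S}].

(* Densities on [0, 1], extended by 0 to the line. *)
Definition kernels (R : realType) : set (R -> R) :=
  [set w : R -> R |
    [/\ measurable_fun setT (w : measurableTypeR R -> measurableTypeR R),
        (forall z, 0 <= w z), (forall z, ~ (0 <= z <= 1) -> w z = 0) &
        law w setT = 1%E]].
Arguments kernels R : clear implicits.

Definition derangetropy (R : realType) (w f : R -> R) (x : R) : R :=
  w (distr_fun f x) * f x.

(* Main.v *)
Require Import Defs.
From HB Require Import structures.
From mathcomp Require Import all_boot all_order all_algebra.
From mathcomp Require Import all_classical all_reals all_analysis.
From mathcomp Require Import measurable_realfun.

(** Equivariance determines Phi from its value at one density with full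
    support.  Take gauss, the standard normal density: for g in Dplus the
    monotone rearrangement [transport g], that is Q_g o F_gauss, is an
    increasing homeomorphism of the line onto the open interval where g is
    positive, and it carries gauss to g ([increasing_homeo_transport],
    [law_transport]).  Hence Phi[g] is the image of Phi[gauss] under
    Q_g o F_gauss, which is the image under Q_g of the fixed measure
    gamma := (F_gauss)_# Phi[gauss]; it lives on ]0, 1[ because F_gauss does.
    The full support is essential here: the admissible maps are defined on the
    whole line, so a bounded reference interval could not be moved onto an
    arbitrary one.

    That Q_g o F_gauss carries gauss to g is the probability integral
    transform: F_f pushes f to the uniform law whatever f is
    ([rank_law_unif]), and therefore Q_f pushes the uniform law to f
    ([law_quantile]).

    For the second part, the quantile function of the uniform density is the
    identity of ]0, 1[, so gamma = Phi[unif], and absolute continuity of this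
    single law makes gamma absolutely continuous; the Radon-Nikodym theorem
    supplies w ([kernel_of_dominated]).  The substitution z = F_f(x), which is
    again the probability integral transform, then turns (Q_f)_# (w dz) into
    the density w(F_f(x)) f(x) ([law_derangetropy]). *)

Set Implicit Arguments.
Unset Strict Implicit.
Unset Printing Implicit Defensive.

Import Order.TTheory GRing.Theory Num.Theory.
Import numFieldNormedType.Exports.

Local Open Scope classical_set_scope.
Local Open Scope ring_scope.

(** * Laws on the line *)

(** The rays ]x, +oo[ are stable under intersection and generate the Borel
    sets, so their probabilities determine the law. *)
Lemma eq_law_cdf (R : realType) (P Q : borel_prob R) :
  (forall x : R, P `]-oo, x]%classic = Q `]-oo, x]%classic) -> eq_law P Q.
Proof.
move=> PQ A mA.
apply: (@measure_unique _ R (measurableTypeR R) (@RGenOInfty.G R)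
  (fun k => `]- k%:R, +oo[%classic)) => //.
- exact: RGenOInfty.measurableE.
- move=> _ _ [x ->] [y ->]; exists (Num.max x y).
  by apply/seteqP; split=> z /=; rewrite !in_itv/= !andbT gt_max => /andP.
- by move=> k; exists (- k%:R).
- rewrite -subTset => x _; exists (Num.truncn `|x|).+1 => //=.
  rewrite in_itv/= andbT ltrNl (le_lt_trans _ (Num.Theory.truncnS_gt _))//.
  by rewrite -normrN ler_norm.
- have tail (S : borel_prob R) (x : R) :
      S `]x, +oo[%classic = (1 - S `]-oo, x]%classic)%E.
    by rewrite -setCitvl; exact: probability_setC.
  by move=> _ [x ->]; apply: etrans (tail P x) _; rewrite PQ; exact/esym/tail.
- by move=> k; rewrite (le_lt_trans (probability_le1 _ _)) ?ltry.
Qed.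

(** * Densities in Dplus, their distribution and quantile functions *)

Section density_law.
Variables (R : realType) (f : Dplus R).
Local Notation mu := (@lebesgue_measure R).
Local Notation supp := [set x | 0 < val f x].
Local Notation F := (distr_fun (val f)).
Local Notation Q := (quantile_fun (val f)).

Let Dplus_supp : [/\ open supp, is_interval supp,
  {within supp, continuous (val f)} & forall x, 0 <= val f x].
Proof.
have := valP f; rewrite inE => -[[I [oI itvI cf fI fN]] _].
have -> : supp = I.
  apply/seteqP; split=> [x /= fx|x /fI//].
  by apply: contrapT => /fN fx0; rewrite fx0 ltxx in fx.
split=> // x; have [/fI/ltW//|/fN ->//] := pselect (I x).
Qed.

Lemma open_supp : open supp. Proof. by case: Dplus_supp. Qed.

Lemma is_interval_supp : is_interval supp. Proof. by case: Dplus_supp. Qed.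

Lemma density_ge0 x : 0 <= val f x. Proof. by case: Dplus_supp. Qed.

Lemma density_eq0 x : ~ supp x -> val f x = 0.
Proof.
by move=> /negP; rewrite -leNgt => fx; apply/eqP; rewrite eq_le fx density_ge0.
Qed.

Lemma law_setT : law (val f) setT = 1%E.
Proof. by have := valP f; rewrite inE => -[]. Qed.

Lemma measurable_density :
  measurable_fun setT (val f : measurableTypeR R -> measurableTypeR R).
Proof.
have [_ _ cf _] := Dplus_supp.
have -> : val f = val f \_ supp.
  apply/funext => x; rewrite patchE; case: ifPn => //.
  by rewrite notin_setE => /density_eq0.
apply/(measurable_restrictT _ (open_measurable open_supp)).
apply: subspace_continuous_measurable_fun => //.
exact: open_measurable open_supp.
Qed.

Let law_ge0 (A : set (measurableTypeR R)) : (0 <= law (val f) A)%E.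
Proof. by apply: integral_ge0 => x _; rewrite lee_fin density_ge0. Qed.

Let law_set0 : law (val f) set0 = 0%E.
Proof. exact: integral_set0. Qed.

Let law_sigma_additive : semi_sigma_additive (law (val f)).
Proof.
move=> A mA tA mUA; rewrite /law; apply: cvg_toP.
  apply: ereal_nondecreasing_is_cvgn => m n mn.
  by apply: lee_sum_nneg_natr => // k _ _; exact: law_ge0.
rewrite ge0_integral_bigcup//=.
  apply: measurable_funTS; apply/measurable_EFinP; exact: measurable_density.
by move=> x _; rewrite lee_fin density_ge0.
Qed.

HB.instance Definition _ := isMeasure.Build _ _ _ (law (val f))
  law_set0 law_ge0 law_sigma_additive.

HB.instance Definition _ := Measure_isProbability.Build _ _ _ (law (val f))
  law_setT.

Lemma law_fin_num A : measurable A -> law (val f) A \is a fin_num.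
Proof. exact: fin_num_measure. Qed.

Lemma integrable_density : mu.-integrable setT (EFin \o val f).
Proof.
apply/integrableP; split.
  by apply/measurable_EFinP; exact: measurable_density.
under eq_integral do rewrite gee0_abs ?lee_fin ?density_ge0//.
by rewrite [X in (X < _)%E]law_setT ltry.
Qed.

Lemma law_dominated : law (val f) `<< mu.
Proof.
apply/null_content_dominatesP => A mA A0.
rewrite -(integral_abs_eq0 (mu := mu) (f := EFin \o val f) mA _ A0).
  by apply: eq_integral => x _; rewrite /= ger0_norm// density_ge0.
apply: measurable_funTS; apply/measurable_EFinP; exact: measurable_density.
Qed.

(** Both the density f and the Radon-Nikodym derivative of its law integrate
    to that law on every Borel set, so they agree almost everywhere. *)
Lemma integral_law A (h : measurableTypeR R -> \bar R) :
    measurable A -> measurable_fun A h -> (forall x, 0 <= h x)%E ->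
  (\int[law (val f)]_(x in A) h x = \int[mu]_(x in A) (h x * (val f x)%:E))%E.
Proof.
move=> mA mh h0.
rewrite -(Radon_Nikodym_SigmaFinite.change_of_variables law_dominated)//.
pose g := Radon_Nikodym_SigmaFinite.f (law (val f)) mu.
have mg : measurable_fun A g.
  apply/measurable_funTS/measurable_int/Radon_Nikodym_SigmaFinite.f_integrable.
  exact: law_dominated.
have mf : measurable_fun A (EFin \o val f).
  by apply: measurable_funTS; apply/measurable_EFinP; exact: measurable_density.
apply: ae_eq_integral => //.
- exact: emeasurable_funM.
- exact: emeasurable_funM.
apply: ae_eqe_mul2l; apply: integral_ae_eq => //.
- apply: (integrableS measurableT) => //.
  exact/Radon_Nikodym_SigmaFinite.f_integrable/law_dominated.
- move=> E EA mE; rewrite -Radon_Nikodym_SigmaFinite.f_integral//.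
  exact: law_dominated.
Qed.

Lemma EFin_distr_fun x : (F x)%:E = law (val f) `]-oo, x]%classic.
Proof. by rewrite /distr_fun /Rintegral fineK//; exact: law_fin_num. Qed.

Lemma distr_fun_ge0 x : 0 <= F x.
Proof. by rewrite -lee_fin EFin_distr_fun. Qed.

Lemma distr_fun_le1 x : F x <= 1.
Proof. by rewrite -lee_fin EFin_distr_fun probability_le1. Qed.

Lemma law_itvoc x y : x <= y -> law (val f) `]x, y]%classic = (F y - F x)%:E.
Proof.
move=> xy; rewrite EFinB !EFin_distr_fun.
have -> : `]x, y]%classic = `]-oo, y] `\` `]-oo, x].
  apply/seteqP; split=> z /=; rewrite !in_itv/=.
    by move=> /andP[xz ->]; split=> //; apply/negP; rewrite -ltNge.
  by move=> [-> /negP]; rewrite -ltNge => ->.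
rewrite measureD//.
  by rewrite setIidr//; exact: subset_itvl.
by rewrite -ge0_fin_numE// fin_num_measure.
Qed.

Lemma distr_fun_nd : {homo F : x y / x <= y}.
Proof. by move=> x y xy; rewrite -subr_ge0 -lee_fin -law_itvoc. Qed.

Lemma law_supp_gt0 A : open A -> A `<=` supp -> A !=set0 ->
  (0 < law (val f) A)%E.
Proof.
move=> oA Af [a Aa].
have mA : measurable (A : set (measurableTypeR R)) by exact: open_measurable.
rewrite lt0e measure_ge0 andbT; apply/eqP => A0.
have muA0 : mu A = 0%E.
  have : ae_eq mu A (EFin \o val f) (cst 0%E).
    apply/ae_eq_integral_abs => //.
      apply: measurable_funTS; apply/measurable_EFinP.
      exact: measurable_density.
    rewrite -[RHS]A0; apply: eq_integral => x _.
    by rewrite /= ger0_norm// density_ge0.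
  move=> [N [mN N0 AN]]; apply: (subset_measure0 mA mN _ N0) => x Ax.
  by apply: AN => /= /(_ Ax) [] fx0; have := Af _ Ax; rewrite /= fx0 ltxx.
have /nbhs_ballP[e /= e0 aeA] := open_nbhs_nbhs (conj oA Aa).
have : (mu (ball a e) <= mu A)%E.
  by apply: le_measure; rewrite ?inE//; exact: measurable_ball.
rewrite muA0 (lebesgue_measure_ball _ (ltW e0)) lee_fin leNgt.
by rewrite mulrn_wgt0.
Qed.

(** One endpoint in the open set supp suffices: points of supp then lie
    strictly between x and y, and the open set they form has positive mass. *)
Lemma distr_fun_lt x y : x < y -> supp x \/ supp y -> F x < F y.
Proof.
move=> xy xy_supp; rewrite -subr_gt0 -lte_fin -law_itvoc ?ltW//.
suff [z [fz /andP[xz zy]]] : exists z, supp z /\ x < z < y.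
  apply: (@lt_le_trans _ _ (law (val f) (supp `&` `]x, y[))).
    apply: law_supp_gt0; last by exists z; rewrite /= in_itv/= xz zy.
    + by apply: openI; [exact: open_supp|exact: interval_open].
    + by move=> ? [].
  apply: le_measure; rewrite ?inE//.
    by apply: measurableI => //; exact: open_measurable open_supp.
  by move=> u [_]; apply: subset_itvl; rewrite bnd_simp.
case: xy_supp => [fx|fy].
  apply: (@filter_ex _ (x^'+)); near=> z; split.
    by near: z; apply: cvg_within; exact: open_nbhs_nbhs (conj open_supp fx).
  by apply/andP; split; near: z; [exact: nbhs_right_gt|exact: nbhs_right_lt].
apply: (@filter_ex _ (y^'-)); near=> z; split.
  by near: z; apply: cvg_within; exact: open_nbhs_nbhs (conj open_supp fy).
by apply/andP; split; near: z; [exact: nbhs_left_gt|exact: nbhs_left_lt].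
Unshelve. all: by end_near. Qed.

(** Absolute continuity of the integral: F y - F x is the mass of ]x, y],
    which is small when the interval is short. *)
Lemma distr_fun_continuous : continuous F.
Proof.
move=> x; apply/cvgrPdist_lt => e e0.
have [d [d0 dP]] := integral_normr_continuous integrable_density e0.
have dF y z : y <= z -> z - y < d -> F z - F y < e.
  move=> yz zyd; rewrite -lte_fin -law_itvoc//.
  have muyz : (mu `]y, z] < d%:E)%E.
    by rewrite lebesgue_measure_itv/=; case: ifP => _; rewrite lte_fin.
  have := dP _ (measurable_itv _) muyz.
  rewrite -lte_fin /Rintegral.
  rewrite (_ : (\int[mu]_(t in _) _)%E = law (val f) `]y, z]%classic).
    by rewrite fineK// law_fin_num.
  by apply: eq_integral => t _; rewrite ger0_norm// density_ge0.
near=> y; have xyd : `|x - y| < d.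
  by near: y; apply/nbhs_ballP; exists d.
have [yx|/ltW xy] := leP y x.
  by rewrite ger0_norm ?subr_ge0 ?distr_fun_nd//; apply: dF => //;
    rewrite (le_lt_trans (ler_norm _)).
rewrite distrC ger0_norm ?subr_ge0 ?distr_fun_nd//; apply: dF => //.
by rewrite (le_lt_trans (ler_norm _))// distrC.
Unshelve. all: by end_near. Qed.

(* A law is the distribution of the identity, so the limits of cdf apply. *)
Let idTR : measurableTypeR R -> R := idfun.

#[local] HB.instance Definition _ :=
  @isMeasurableFun.Build _ _ _ _ idTR (@measurable_id _ _ setT).

Lemma distr_funNy e : 0 < e -> exists x, F x < e.
Proof.
move=> e0; have /fine_cvg cF := cvg_cdfNy0 (idTR : {RV (law (val f)) >-> R}).
by have /(_ _)/filter_ex[x Fx] := cvgr_lt _ cF _ e0; exists x.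
Qed.

Lemma distr_funy e : e < 1 -> exists x, e < F x.
Proof.
move=> e1; have /fine_cvg cF := cvg_cdfy1 (idTR : {RV (law (val f)) >-> R}).
by have /(_ _)/filter_ex[x Fx] := cvgr_gt _ cF _ e1; exists x.
Qed.

Lemma distr_fun_lt_supp x y : F x < F y -> exists2 z, x < z <= y & supp z.
Proof.
move=> Fxy; have xy : x <= y.
  by rewrite leNgt; apply/negP => /ltW/distr_fun_nd; rewrite leNgt Fxy.
apply: contrapT => noz; move: Fxy; rewrite -subr_gt0 -lte_fin -law_itvoc//.
rewrite (_ : law _ _ = 0%E) ?ltxx//; apply: integral0_eq => z /=.
rewrite in_itv/= => xzy; rewrite density_eq0// => fz.
by apply: noz; exists z.
Qed.

(** The intermediate value theorem gives x with F x = t, and such an x must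
    lie in supp: as F takes values below and above t, mass is found on both
    sides of x, and supp is an interval. *)
Lemma distr_fun_surj t : 0 < t < 1 -> exists2 x, supp x & F x = t.
Proof.
move=> /andP[t0 t1].
have [[a Fa] [b Fb]] := (distr_funNy t0, distr_funy t1).
have ab : a <= b.
  rewrite leNgt; apply/negP => /ltW/distr_fun_nd.
  by rewrite leNgt (lt_trans Fa).
have [x _ Fx] : exists2 x, x \in `[a, b] & F x = t.
  apply: IVT => //.
    exact/continuous_subspaceT/distr_fun_continuous.
  by rewrite ge_min le_max (ltW Fa) (ltW Fb) orbT.
exists x => //.
have [z1 /andP[_ z1x] fz1] : exists2 z, a < z <= x & supp z.
  by apply: distr_fun_lt_supp; rewrite Fx.
have [z2 /andP[xz2 _] fz2] : exists2 z, x < z <= b & supp z.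
  by apply: distr_fun_lt_supp; rewrite Fx.
by apply: (is_interval_supp fz1 fz2); rewrite z1x ltW.
Qed.

Lemma distr_fun_itvoo x : supp x -> 0 < F x < 1.
Proof.
move=> fx; apply/andP; split.
  apply: le_lt_trans (distr_fun_ge0 (x - 1)) _.
  by apply: distr_fun_lt; [rewrite gtrBl|right].
apply: lt_le_trans (distr_fun_le1 (x + 1)).
by apply: distr_fun_lt; [rewrite ltrDl|left].
Qed.

Lemma distr_fun_inj : {in supp &, injective F}.
Proof.
move=> x y; rewrite !inE => fx fy Fxy; apply/eqP; rewrite eq_le.
by apply/andP; split; rewrite leNgt; apply/negP => /distr_fun_lt;
  [move=> /(_ (or_introl fy))|move=> /(_ (or_introl fx))]; rewrite Fxy ltxx.
Qed.

Lemma distr_funK x : supp x -> Q (F x) = x.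
Proof. by move=> fx; apply: pinvKV; [exact: distr_fun_inj|rewrite inE]. Qed.

Lemma quantile_funK t : 0 < t < 1 -> F (Q t) = t.
Proof.
by move=> /distr_fun_surj[x fx <-]; rewrite distr_funK.
Qed.

Lemma quantile_supp t : 0 < t < 1 -> supp (Q t).
Proof.
by move=> /distr_fun_surj[x fx <-]; rewrite distr_funK.
Qed.

(** The default value of the pointed inverse; it is what makes Q Borel on the
    whole line and not only on ]0, 1[. *)
Lemma quantile_fun_out t : ~ (0 < t < 1) -> Q t = point.
Proof.
move=> t01; have : ~ (F @` supp) t.
  by move=> [x /distr_fun_itvoo] + Ft; rewrite Ft.
rewrite /quantile_fun/= => Ft.
rewrite /pinv_/= splitV /=.
(* The partial inverse of a map onto its image is None off the image. *)
rewrite (@oinv_surj _ _ _ _ _ (fun _ => id : (_ @` _) _ -> _)).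
by case: pselect.
Qed.


Lemma quantile_fun_lt s t : 0 < s -> s < t -> t < 1 -> Q s < Q t.
Proof.
move=> s0 st t1; rewrite ltNge; apply/negP => /distr_fun_nd.
rewrite !quantile_funK ?leNgt ?st//; first by rewrite s0 (lt_trans st).
by rewrite (lt_trans s0).
Qed.

(** Q is monotone with an open image: two points Q t - m and Q t + m of supp
    are sent by F to either side of t, and Q stays between them on the
    resulting neighbourhood of t. *)
Lemma quantile_fun_continuous t : 0 < t < 1 -> {for t, continuous Q}.
Proof.
move=> t01; apply/cvgrPdist_lt => e e0.
have /nbhs_ballP[d /= d0 dsupp] : nbhs (Q t) supp.
  by apply: open_nbhs_nbhs; split; [exact: open_supp|exact: quantile_supp].
pose m := Num.min d e / 2.
have m0 : 0 < m by rewrite divr_gt0// lt_min d0.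
have [md me] : m < d /\ m < e.
  have : m < Num.min d e by rewrite gtr_pMr ?invf_lt1 ?ltr1n// lt_min d0.
  by rewrite lt_min => /andP.
(* m is less than e, and so small that Q t - m and Q t + m are in supp. *)
have suppm : supp (Q t - m).
  by apply: dsupp; rewrite /ball/= opprB addrC subrK gtr0_norm.
have suppp : supp (Q t + m).
  by apply: dsupp; rewrite /ball/= opprD addrA subrr add0r normrN gtr0_norm.
have ltm : F (Q t - m) < t.
  rewrite -[ltRHS]quantile_funK//.
  by apply: distr_fun_lt; [rewrite gtrBl|left].
have ltp : t < F (Q t + m).
  rewrite -[ltLHS]quantile_funK//.
  by apply: distr_fun_lt; [rewrite ltrDl|right].
have /andP[mgt0 _] := distr_fun_itvoo suppm.
have /andP[_ plt1] := distr_fun_itvoo suppp.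
near=> s.
have ms : F (Q t - m) < s by near: s; exact: lt_nbhsr.
have sp : s < F (Q t + m) by near: s; exact: lt_nbhsl.
have := quantile_fun_lt mgt0 ms (lt_trans sp plt1).
have := quantile_fun_lt (lt_trans mgt0 ms) sp plt1.
rewrite !distr_funK// => Qsp Qms; rewrite (lt_trans _ me)// ltr_norml.
by rewrite ltrBrDr addrC ltrBlDr Qsp/= ltrBlDr addrC -ltrBlDr.
Unshelve. all: by end_near. Qed.

Lemma measurable_distr_fun :
  measurable_fun setT (F : measurableTypeR R -> measurableTypeR R).
Proof. by apply: continuous_measurable_fun; exact: distr_fun_continuous. Qed.

Lemma measurable_quantile_fun :
  measurable_fun setT (Q : measurableTypeR R -> measurableTypeR R).
Proof.
rewrite -(setUv `]0, 1[); apply/measurable_funU => //; first exact: measurableC.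
split.
  apply: open_continuous_measurable_fun; first exact: interval_open.
  by move=> t; rewrite inE/= in_itv/= => /quantile_fun_continuous.
apply: (eq_measurable_fun (cst point)); last exact: measurable_cst.
by move=> t; rewrite inE/= in_itv/= => /quantile_fun_out ->.
Qed.

Lemma measurable_quantile_preimage (A : set (measurableTypeR R)) :
  measurable A ->
  measurable ((Q : measurableTypeR R -> measurableTypeR R) @^-1` A).
Proof.
by move=> mA; rewrite -[X in measurable X]setTI; exact: measurable_quantile_fun.
Qed.

Let Fm : measurableTypeR R -> measurableTypeR R := F.

#[local] HB.instance Definition _ :=
  @isMeasurableFun.Build _ _ _ _ Fm measurable_distr_fun.

(** The law of F_f(X) when X has law P, packaged as a probability measure. *)
Definition rank_law (P : borel_prob R) : borel_prob R := distribution P Fm.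

Lemma rank_lawE P A : rank_law P A = P (F @^-1` A). Proof. by []. Qed.

(** On supp, Q undoes F, so A and its image under the round trip differ only
    where the integrand vanishes. *)
Lemma integral_supp_quantile (A : set (measurableTypeR R))
    (h : measurableTypeR R -> \bar R) : (forall x, ~ supp x -> h x = 0%E) ->
  (\int[mu]_(x in A) h x = \int[mu]_(x in F @^-1` (Q @^-1` A)) h x)%E.
Proof.
move=> h0; rewrite integral_mkcond [RHS]integral_mkcond.
apply: eq_integral => x _; have [fx|/h0 hx] := pselect (supp x).
  rewrite !patchE; congr (if _ then _ else _).
  by apply: asbool_equiv_eq => /=; rewrite distr_funK.
by rewrite !patchE hx !if_same.
Qed.

(** The right-hand side does not mention f: all densities have the same law of
    ranks. *)
Lemma rank_law_cdf t : rank_law (law (val f)) `]-oo, t]%classic =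
  (if t <= 0 then 0 else if 1 <= t then 1 else t)%:E.
Proof.
rewrite rank_lawE; case: ifPn => [t0|].
  apply: integral0_eq => x/=; rewrite in_itv/= => Fx.
  rewrite density_eq0// => /distr_fun_itvoo /andP[].
  by rewrite ltNge (le_trans Fx).
rewrite -ltNge => t0; case: ifPn => [t1|].
  have -> : F @^-1` `]-oo, t]%classic = setT; last exact: law_setT.
  apply/seteqP; split=> // x _ /=.
  by rewrite in_itv/= (le_trans (distr_fun_le1 x)).
rewrite -ltNge => t1; have t01 : 0 < t < 1 by rewrite t0.
rewrite -[RHS](congr1 EFin (quantile_funK t01)) EFin_distr_fun.
congr (law _ _); apply/seteqP; split=> x /=; rewrite !in_itv/=; last first.
  by move=> /distr_fun_nd; rewrite quantile_funK.
move=> Fx; rewrite leNgt; apply/negP => /distr_fun_lt.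
move=> /(_ (or_introl (quantile_supp t01))).
by rewrite quantile_funK// ltNge Fx.
Qed.

End density_law.

(** * The probability integral transform *)

Section uniform_reference.
Variable R : realType.
Local Notation mu := (@lebesgue_measure R).

Definition unif_density (x : R) : R := if 0 < x < 1 then 1 else 0.

Lemma law_unif_density (A : set (measurableTypeR R)) : measurable A ->
  law unif_density A = mu (A `&` `]0, 1[).
Proof.
move=> mA; rewrite setIC -integral_indic//; apply: eq_integral => x _.
rewrite /unif_density indicE; congr (_%:E).
by rewrite mem_setE in_itv/=; case: ifP.
Qed.

Lemma unif_density_Dplus : Dplus R unif_density.
Proof.
split; last first.
  by rewrite law_unif_density// setTI lebesgue_measure_itv/= lte01 oppr0 adde0.
exists `]0, 1[%classic; split.
- exact: interval_open.
- exact: interval_is_interval.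
- apply: continuous_in_subspaceT => x; rewrite inE/= in_itv/= => x01.
  rewrite /continuous_at {2}/unif_density x01; apply: cvg_near_cst.
  have : \forall y \near x, y \in `]0, 1[ by exact: near_in_itvoo.
  by apply: filterS => y; rewrite in_itv/= /unif_density => ->.
- by move=> x /=; rewrite in_itv/= /unif_density => ->.
- by move=> x /= /negP; rewrite in_itv/= /unif_density => /negbTE ->.
Qed.

Definition unif : Dplus R := exist _ unif_density (mem_set unif_density_Dplus).

Lemma unif_supp x : 0 < val unif x -> 0 < x < 1.
Proof. by rewrite /= /unif_density; case: ifPn => //; rewrite ltxx. Qed.

Lemma distr_fun_unif x : 0 < x < 1 -> distr_fun (val unif) x = x.
Proof.
move=> /andP[x0 x1]; apply: EFin_inj; rewrite EFin_distr_fun.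
rewrite law_unif_density//.
have -> : `]-oo, x]%classic `&` `]0, 1[%classic = `]0, x]%classic.
  apply/seteqP; split=> z /=; rewrite !in_itv/=.
    by move=> [-> /andP[-> _]].
  by move=> /andP[-> zx]; rewrite zx (le_lt_trans zx).
by rewrite lebesgue_measure_itv/= lte_fin x0 oppr0 adde0.
Qed.

Lemma quantile_fun_unif x : 0 < x < 1 -> quantile_fun (val unif) x = x.
Proof.
move=> x01; rewrite -[in LHS](distr_fun_unif x01) distr_funK//=.
by rewrite /unif_density x01.
Qed.

(** By [rank_law_cdf] the law of F_f under f does not depend on f, so it may be
    computed for f uniform, where F_f is the identity on the support. *)
Lemma rank_law_unif (f : Dplus R) :
  eq_law (rank_law f (law (val f))) (law (val unif)).
Proof.
move=> A mA.
transitivity (rank_law unif (law (val unif)) A).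
  apply: (eq_law_cdf (Q := rank_law unif (law (val unif)))) => // x.
  by rewrite !rank_law_cdf.
rewrite rank_lawE -[LHS]/(law (val unif) (distr_fun (val unif) @^-1` A)).
rewrite /law integral_mkcond [RHS]integral_mkcond.
apply: eq_integral => x _.
have [ux|/density_eq0 ux] := pselect (0 < val unif x).
  rewrite !patchE; congr (if _ then _ else _).
  by apply: asbool_equiv_eq => /=; rewrite distr_fun_unif// unif_supp.
by rewrite !patchE ux !if_same.
Qed.

Lemma law_quantile (f : Dplus R) :
  eq_law (law (val f)) (pushforward (law (val unif))
    (quantile_fun (val f) : measurableTypeR R -> measurableTypeR R)).
Proof.
move=> A mA.
rewrite /law (@integral_supp_quantile _ f) => [|x /density_eq0 ->//].
apply: etrans (rank_law_unif f _); first by [].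
exact: measurable_quantile_preimage.
Qed.

End uniform_reference.

(** * Transport from a density with full support *)

Section full_support.
Variable R : realType.

Lemma normal_pdf_gt0 x : 0 < normal_pdf (0 : R) 1 x.
Proof.
rewrite normal_pdfE ?oner_neq0// mulr_gt0 ?expR_gt0//.
exact/normal_peak_gt0/oner_neq0.
Qed.

Lemma normal_pdf_Dplus : Dplus R (normal_pdf 0 1).
Proof.
split; last exact: integral_normal_pdf.
exists setT; split=> //.
- exact: openT.
- exact/continuous_subspaceT/continuous_normal_pdf/oner_neq0.
- by move=> x _; exact: normal_pdf_gt0.
- by move=> x /(_ I).
Qed.

Definition gauss : Dplus R :=
  exist _ (normal_pdf 0 1) (mem_set normal_pdf_Dplus).

Lemma gauss_gt0 x : 0 < val gauss x.
Proof. exact: normal_pdf_gt0. Qed.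

Lemma distr_fun_gauss x : 0 < distr_fun (val gauss) x < 1.
Proof. exact/distr_fun_itvoo/gauss_gt0. Qed.

(** The monotone rearrangement of the normal law into g. *)
Definition transport (g : Dplus R) (x : R) :=
  quantile_fun (val g) (distr_fun (val gauss) x).

Lemma range_transport (g : Dplus R) :
  range (transport g) = [set x | 0 < val g x].
Proof.
apply/seteqP; split=> [_ [x _ <-]|y gy].
  exact/quantile_supp/distr_fun_gauss.
exists (quantile_fun (val gauss) (distr_fun (val g) y)) => //.
rewrite /transport quantile_funK ?distr_funK//.
exact: distr_fun_itvoo.
Qed.

Lemma increasing_homeo_transport (g : Dplus R) : increasing_homeo (transport g).
Proof.
split.
- move=> x y xy; have /andP[x0 _] := distr_fun_gauss x.
  have /andP[_ y1] := distr_fun_gauss y.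
  apply: quantile_fun_lt => //; apply: distr_fun_lt => //.
  by left; exact: gauss_gt0.
- move=> x; apply: continuous_comp; first exact: distr_fun_continuous.
  exact/quantile_fun_continuous/distr_fun_gauss.
- by rewrite range_transport; exact: open_supp.
- by rewrite range_transport; exact: is_interval_supp.
- exists (quantile_fun (val gauss) \o distr_fun (val g)) => [x|].
    rewrite /= /transport quantile_funK ?distr_fun_gauss//.
    exact: distr_funK (gauss_gt0 x).
  rewrite range_transport; apply: continuous_in_subspaceT => y.
  rewrite inE => gy; apply: continuous_comp; first exact: distr_fun_continuous.
  exact/quantile_fun_continuous/distr_fun_itvoo.
Qed.

Lemma law_transport (g : Dplus R) :
  eq_law (law (val g)) (pushforward (law (val gauss))
    (transport g : measurableTypeR R -> measurableTypeR R)).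
Proof.
move=> A mA; rewrite law_quantile//; apply/esym/rank_law_unif.
exact: measurable_quantile_preimage.
Qed.

End full_support.

(** * The kernel of an absolutely continuous law on the unit interval *)

Lemma probability_setI d (T : measurableType d) (R : realType)
    (P : probability T R) (A B : set T) :
  measurable A -> measurable B -> P B = 1%E -> P (A `&` B) = P A.
Proof.
move=> mA mB PB1; have PC0 : P (~` B) = 0%E.
  by rewrite probability_setC// PB1 subee.
rewrite [RHS](measureDI P mA mB).
rewrite [X in _ = (X + _)%E](subset_measure0 _ _ _ PC0) ?add0e//.
- exact: measurableD.
- exact: measurableC.
Qed.

Section dominated_by_lebesgue.
Variables (R : realType) (gamma : borel_prob R).
Local Notation mu := (@lebesgue_measure R).
Hypothesis gamma01 : gamma `]0, 1[%classic = 1%E.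

(** The Radon-Nikodym derivative is cut off outside ]0, 1[, a set of full gamma
    measure.  Vanishing at the endpoints too, which a kernel need not do, lets
    [law_derangetropy] multiply w by the uniform density freely. *)
Lemma kernel_of_dominated : gamma `<< mu ->
  exists w, [/\ kernels R w, (forall z, ~ (0 < z < 1) -> w z = 0) &
    eq_law gamma (law w)].
Proof.
move=> dom.
have gammaI (A : set (measurableTypeR R)) : measurable A ->
    gamma (A `&` `]0, 1[%classic) = gamma A.
  by move=> mA; exact: probability_setI.
pose g := Radon_Nikodym_SigmaFinite.f gamma mu.
have gE A : measurable A -> gamma A = (\int[mu]_(x in A) g x)%E.
  by move=> mA; exact: Radon_Nikodym_SigmaFinite.f_integral.
pose w := (fine \o g) \_ `]0, 1[%classic.
have w0 z : ~ (0 < z < 1) -> w z = 0.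
  by move=> z01; rewrite /w patchE mem_setE in_itv/=; case: ifP z01.
have gw : eq_law gamma (law w).
  move=> A mA; rewrite -gammaI// gE ?integral_mkcondr; last exact: measurableI.
  apply: eq_integral => x _; rewrite /w !patchE.
  case: ifPn => // _; rewrite fineK//.
  exact: Radon_Nikodym_SigmaFinite.f_fin_num.
exists w; split=> //; split.
- apply/(measurable_restrictT _ (measurable_itv `]0, 1[)).
  apply: measurable_funTS.
  apply: measurableT_comp => //.
  exact: measurable_int (Radon_Nikodym_SigmaFinite.f_integrable dom).
- move=> z; rewrite /w patchE; case: ifPn => // _.
  exact/fine_ge0/Radon_Nikodym_SigmaFinite.f_ge0.
- by move=> z z01; apply: w0 => /andP[z0 z1]; apply: z01; rewrite !ltW.
- by rewrite -gw// probability_setT.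
Qed.

End dominated_by_lebesgue.

(** Substitution z = F_f(x): integrating w over Q^-1(A) against the uniform law,
    which is the law of F_f under f, is integrating w o F_f over
    F^-1(Q^-1(A)) against f, and this set is A up to points where f is 0. *)
Lemma law_derangetropy (R : realType) (w : R -> R) (f : Dplus R) :
    kernels R w -> (forall z, ~ (0 < z < 1) -> w z = 0) ->
  eq_law (pushforward (law w)
      (quantile_fun (val f) : measurableTypeR R -> measurableTypeR R))
    (law (derangetropy w (val f))).
Proof.
move=> [mw w0 _ _] w01 A mA.
have mQA : measurable (quantile_fun (val f) @^-1` A).
  exact: measurable_quantile_preimage.
have mFQA : measurable (distr_fun (val f) @^-1` (quantile_fun (val f) @^-1` A)).
  by rewrite -[X in measurable X]setTI; exact: measurable_distr_fun.
have mEw : measurable_fun setT (EFin \o w : measurableTypeR R -> \bar R).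
  by apply/measurable_EFinP; exact: mw.
rewrite /law/= [RHS](integral_supp_quantile (f := f)); last first.
  by move=> x /density_eq0 fx; rewrite /derangetropy fx mulr0.
transitivity (\int[law (val (unif R))]_(z in quantile_fun (val f) @^-1` A)
    (w z)%:E)%E.
  rewrite integral_law//; last exact: measurable_funTS.
  apply: eq_integral => z _; rewrite /= /unif_density.
  by case: ifPn => [_|/negP/w01 ->]; rewrite ?mule1 ?mul0e.
transitivity (\int[rank_law f (law (val f))]_(z in quantile_fun (val f) @^-1` A)
    (w z)%:E)%E.
  by apply: eq_measure_integral => B mB _; exact/esym/rank_law_unif.
rewrite (ge0_integral_pushforward (measurable_distr_fun f))//; last 2 first.
- exact: measurable_funTS.
- by move=> z _; rewrite lee_fin.
rewrite integral_law//.
  apply: measurable_funTS.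
  exact: measurableT_comp mEw (measurable_distr_fun f).
by move=> x; rewrite lee_fin.
Qed.

(** * Equivariant maps *)

Theorem theorem2 (R : realType) (Phi : Dplus R -> borel_prob R)
  (equivariant : forall (f g : Dplus R)
     (T : measurableTypeR R -> measurableTypeR R),
     increasing_homeo T ->
     eq_law (law (val g)) (pushforward (law (val f)) T) ->
     eq_law (Phi g) (pushforward (Phi f) T)) :
  exists gamma : borel_prob R,
    [/\ gamma `]0, 1[%classic = 1%E,
        (forall f : Dplus R, eq_law (Phi f)
           (pushforward gamma
              (quantile_fun (val f) :
                 measurableTypeR R -> measurableTypeR R))) &
        ((forall f : Dplus R, Phi f `<< @lebesgue_measure R) ->
         exists w : R -> R,
           [/\ kernels R w, eq_law gamma (law w) &
               forall f : Dplus R,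
                 eq_law (Phi f) (law (derangetropy w (val f)))])].
Proof.
pose gamma := rank_law (gauss R) (Phi (gauss R)).
have gamma01 : gamma `]0, 1[%classic = 1%E.
  rewrite /gamma rank_lawE (_ : _ @^-1` _ = setT) ?probability_setT//.
  by apply/seteqP; split=> // x _ /=; rewrite in_itv/= distr_fun_gauss.
have PhiE (f : Dplus R) : eq_law (Phi f) (pushforward gamma
    (quantile_fun (val f) : measurableTypeR R -> measurableTypeR R)).
  move=> A mA.
  have homeo := increasing_homeo_transport f.
  by rewrite (equivariant _ _ _ homeo (law_transport f)).
exists gamma; split=> // dom.
have gammaE : eq_law gamma (Phi (unif R)).
  move=> A mA; rewrite PhiE//.
  have gammaI (B : set (measurableTypeR R)) : measurable B ->
      gamma (B `&` `]0, 1[%classic) = gamma B.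
    by move=> mB; exact: probability_setI.
  rewrite /pushforward -gammaI// -[RHS]gammaI; last first.
    exact: measurable_quantile_preimage.
  congr (gamma _); apply/seteqP; split=> x [/= Ax]; rewrite in_itv/= => x01.
    by split; rewrite ?quantile_fun_unif//= in_itv.
  by rewrite quantile_fun_unif// in Ax; split; rewrite //= in_itv.
have [w [kw w01 gw]] : exists w, [/\ kernels R w,
    (forall z, ~ (0 < z < 1) -> w z = 0) & eq_law gamma (law w)].
  apply: kernel_of_dominated => //; apply/null_content_dominatesP => A mA A0.
  by rewrite gammaE//; have /null_content_dominatesP := dom (unif R); apply.
exists w; split=> // f A mA.
rewrite PhiE// -law_derangetropy//; apply: gw.
exact: measurable_quantile_preimage.
Qed.
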